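(* Let $(\mathfrak g,\top_{\mathfrak g},[\,,])$ be a locality Lie algebra, $(A,\top_A)$ a locality algebra and $f:\mathfrak g\to A$ a locality Lie algebra morphism, where the Lie bracket on $A$ is the commutator defined by the product. Assume that (a) for every $n\in\mathbb{N}$ the subspace $I^n_{\rm mult}(\mathfrak g)\cap F^n(\mathfrak g)\subset F^n(\mathfrak g)$ is locality compatible with $\top^n_\times$, and (b) the ideal $J_\top(\mathfrak g)$ of $\mathcal{T}_\top(\mathfrak g)$ is locality compatible with $\top_\otimes$. Then there is a unique locality algebra morphism $\phi:(U_\top(\mathfrak g),\top_U)\to(A,\top_A)$ such that $f=\phi\circ\iota_{\mathfrak g}$, where $\iota_{\mathfrak g}:\mathfrak g\to U_\top(\mathfrak g)$ is the canonical map.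
   Context: $\mathbb{K}$ is $\mathbb{R}$ or $\mathbb{C}$. A locality vector space is a vector space $V$ with a symmetric relation $\top\subset V\times V$ containing $(0,0)$ such that for every $U\subset V$ the polar set $U^\top=\{x: x\top u\ \forall u\in U\}$ is a linear subspace. A locality linear map is a linear map sending related pairs to related pairs. A subspace $W$ of a locality vector space $(V,\top)$ is locality compatible with $\top$ if for all $(x,y,z)\in V^3$ and $w\in W$ with $x\top y$ and $(x+w)\top z$, there is $w'\in W$ with $(x+w')\top y$ and $(x+w')\top z$. $\mathbb{K}(X)$ is the free vector space on $X$. Tensor algebra of $(V,\top)$: for $k\ge1$, $V^{\times_\top k}=\{(x_1,\dots,x_k)\in V^k: x_i\top x_j\ \forall i\ne j\}$; $I_{{\rm mult},k}(V)\subset\mathbb{K}(V^k)$ is spanned by all $(\dots,a_i+b_i,\dots)-(\dots,a_i,\dots)-(\dots,b_i,\dots)$ and $(\dots,cx_i,\dots)-c(\dots,x_i,\dots)$, $c\in\mathbb{K}$. $V^{\otimes_\top k}=\mathbb{K}(V^{\times_\top k})/(I_{{\rm mult},k}(V)\cap\mathbb{K}(V^{\times_\top k}))$, $V^{\otimes_\top 0}=\mathbb{K}$, $\mathcal{T}_\top(V)=\bigoplus_{k\ge0}V^{\otimes_\top k}$. Set $F^n(V)=\mathbb{K}\cdot1\oplus\bigoplus_{k=1}^n\mathbb{K}(V^{\times_\top k})$ and $I^n_{\rm mult}(V)=\bigoplus_{k=1}^nI_{{\rm mult},k}(V)$. Tuples $(x_i)$, $(y_j)$ are $\top^n_\times$-related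 iff $x_i\top y_j$ for all $i,j$; $1$ is related to every basis element; two elements of $F^n(V)$ are related iff all basis elements with nonzero coefficient in the first are related to all those in the second. Two elements of $\mathcal{T}_\top(V)$ are $\top_\otimes$-related iff for some $n$ they have $\top_\times^n$-related representatives in $F^n(V)$. The product is the tensor product restricted to $\top_\otimes$, with unit $\mathbb{K}=V^{\otimes_\top0}$. For a locality vector space $(A,\top)$, a map on $A\times_\top A:=\top$ is $\top_\times$-bilinear if its linear extension to $\mathbb{K}(\top)$ vanishes on $I_{{\rm mult},2}(A)\cap\mathbb{K}(\top)$; it is locality $\top_\times$-bilinear if moreover $a\top a'$ and $b\top b'$ imply that the images of $(a,b),(a',b')\in\top$ are related. A locality algebra $(A,\top,m,u)$ is a locality vector space with a $\top_\times$-bilinear product $m:\top\to A$ such that $m(m(x,y),z)=m(x,m(y,z))$ for pairwise independent $x,y,z$ whenever both sides are defined, $m((U^\top\times U^\top)\cap\top)\subset U^\top$ for every $U\subset A$, and a linear unit $u:\mathbb{K}\to A$ with $u(\mathbb{K})\subset A^\top$ and $m(u(c),a)=ca=m(a,u(c))$. A locality algebra morphism is a locality linear map $g$ with $g(m_1(x,y))=m_2(g(x),g(y))$ for $x\top_1y$, preserving units. A (pre-)locality ideal of $A$ is a subspace $I$ with $m(I\times I^\top)\subset I$ and $m(I^\top\times I)\subset I$. A locality Lie algebra is a locality vector space $(\mathfrak g,\top_{\mathfrak g})$ with an antisymmetric locality $\top_\times$-bilinear map $[\,,]:\top_{\mathfrak g}\to\mathfrak g$ mapping $(U^\top\times U^\top)\cap\top_{\mathfrak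 g}$ into $U^\top$ for every $U\subset\mathfrak g$ and satisfying the Jacobi identity for pairwise independent $a,b,c$. A locality Lie algebra morphism is a locality linear map with $f([x,y])=[f(x),f(y)]$ whenever $x\top y$. On $A$, $[x,y]=xy-yx$ for $x\top_Ay$. $J_\top(\mathfrak g)$ is the (pre-)locality ideal of $\mathcal{T}_\top(\mathfrak g)$ generated by all $a\otimes b-b\otimes a-[a,b]$, $(a,b)\in\top_{\mathfrak g}$. $U_\top(\mathfrak g)=\mathcal{T}_\top(\mathfrak g)/J_\top(\mathfrak g)$ with induced product and unit; $x\top_Uy$ iff there are representatives $a\in x$, $b\in y$ with $a\top_\otimes b$. $\iota_{\mathfrak g}$ is the composition $\mathfrak g\to\mathcal{T}_\top(\mathfrak g)\to U_\top(\mathfrak g)$.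
   Formalization: The induced product of the enveloping algebra need not be single valued, even under (a) and (b), so it is taken as a relation, and a morphism must respect every value of it; J is the intersection of all (pre-)locality ideals containing the generators. *)

(* Defs.v *)
From HB Require Import structures.
From mathcomp Require Import all_boot all_order all_algebra.
From mathcomp Require Import boolp classical_sets reals.
From mathcomp Require Import complex.
From mathcomp Require Import finmap monalg.

Set Implicit Arguments.
Unset Strict Implicit.
Unset Printing Implicit Defensive.

Import GRing.Theory.
Local Open Scope ring_scope.
Local Open Scope quotient_scope.
Local Open Scope classical_set_scope.

Definition is_R_or_C (K : fieldType) : Prop :=
  exists R : realType, K = (R : fieldType) \/ K = (R[i] : fieldType).

Section Subspaces.
Variables (K : fieldType) (V : lmodType K).

Definition is_subspace (W : set V) : Prop :=
  W 0 /\ forall (c : K) x y, W x -> W y -> W (c *: x + y).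

Record subspace := Subspace {
  subspace_set :> V -> Prop;
  subspaceP : is_subspace subspace_set }.

Lemma span_is_subspace (S : set V) :
  is_subspace [set x | forall W : subspace, S `<=` W -> W x].
Proof.
split=> [W _|c x y hx hy W hW]; first by case: (subspaceP W).
by case: (subspaceP W) => _; apply; [exact: hx | exact: hy].
Qed.

Definition span (S : set V) : subspace := Subspace (span_is_subspace S).

Definition in_subspace (W : subspace) : {pred V} := fun x => `[< W x >].

Lemma in_subspace_zmod (W : subspace) : zmod_closed (in_subspace W).
Proof.
case: W => W [W0 WD]; split=> [|x y]; first exact/asboolP.
move=> /asboolP /= Wx /asboolP /= Wy; apply/asboolP => /=.
by rewrite addrC -scaleN1r; exact: WD.
Qed.

HB.instance Definition _ (W : subspace) :=
  GRing.isZmodClosed.Build V (in_subspace W) (in_subspace_zmod W).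

Definition vquot (W : subspace) := Quotient.quot (in_subspace W).

HB.instance Definition _ (W : subspace) := GRing.Zmodule.on (vquot W).

Definition vproj (W : subspace) (x : V) : vquot W :=
  \pi_(Quotient.quot (in_subspace W)) x.

Definition vrepr (W : subspace) (x : vquot W) : V :=
  repr (x : Quotient.quot (in_subspace W)).

Definition vquot_scale (W : subspace) (c : K) (x : vquot W) : vquot W :=
  vproj W (c *: vrepr x).

Section QuotientTheory.
Variable W : subspace.

Lemma vreprK : cancel (@vrepr W) (vproj W).
Proof. by move=> x; exact: reprK. Qed.

Lemma vproj_eq x y : (vproj W x = vproj W y) <-> W (x - y).
Proof.
split=> [/eqP|h].
  by rewrite /vproj -Quotient.idealrBE => /asboolP.
by apply/eqP; rewrite /vproj -Quotient.idealrBE; apply/asboolP.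
Qed.

Lemma vprojD x y : vproj W (x + y) = vproj W x + vproj W y.
Proof. by rewrite /vproj !piE. Qed.

Lemma vprojZ c x : vproj W (c *: x) = vquot_scale c (vproj W x).
Proof.
apply/vproj_eq; rewrite -scalerBr; case: (subspaceP W) => W0 WD.
by rewrite -[_ *: _]addr0; apply: WD => //; apply/vproj_eq; rewrite vreprK.
Qed.

Lemma vquot_scalerA (a b : K) (x : vquot W) :
  vquot_scale a (vquot_scale b x) = vquot_scale (a * b) x.
Proof. by rewrite -[x]vreprK -!vprojZ scalerA. Qed.

Lemma vquot_scale1r : left_id 1 (@vquot_scale W).
Proof. by move=> x; rewrite -[x]vreprK -vprojZ scale1r. Qed.

Lemma vquot_scalerDr : right_distributive (@vquot_scale W) +%R.
Proof.
by move=> c x y; rewrite -[x]vreprK -[y]vreprK -vprojD -!vprojZ scalerDr vprojD.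
Qed.

Lemma vquot_scalerDl (x : vquot W) :
  {morph (@vquot_scale W)^~ x : a b / a + b}.
Proof. by move=> a b; rewrite -[x]vreprK -!vprojZ scalerDl vprojD. Qed.

HB.instance Definition _ := GRing.Zmodule_isLmodule.Build K (vquot W)
  vquot_scalerA vquot_scale1r vquot_scalerDr vquot_scalerDl.

Lemma vproj_is_linear : linear (vproj W).
Proof. by move=> c x y; rewrite vprojD vprojZ. Qed.

HB.instance Definition _ :=
  GRing.isLinear.Build K V (vquot W) _ (vproj W) vproj_is_linear.

End QuotientTheory.
End Subspaces.

(* The free vector space K(X) is {malg K[X]}; [linext h] is the linear
   extension to K(X) of a map h on the basis X. *)
Section LinearExtension.
Variables (K : fieldType) (X : choiceType) (W : lmodType K) (h : X -> W).

Definition linext (t : {malg K[X]}) : W := \sum_(k <- msupp t) t@_k *: h k.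

Lemma linextEw (t : {malg K[X]}) (d : {fset X}) :
  {subset msupp t <= d} -> linext t = \sum_(k <- d) t@_k *: h k.
Proof.
move=> /fsubsetP hd; rewrite /linext (big_fset_incl _ hd) // => k _ hk.
by rewrite mcoeff_outdom ?scale0r.
Qed.

Lemma linext_is_linear : linear linext.
Proof.
move=> c x y.
pose d := (msupp x `|` msupp y `|` msupp (c *: x + y))%fset.
rewrite !(@linextEw _ d); try by move=> k; rewrite !inE => ->; rewrite ?orbT.
rewrite scaler_sumr -big_split; apply: eq_bigr => k _ /=.
by rewrite mcoeffD mcoeffZ scalerDl scalerA.
Qed.

HB.instance Definition _ :=
  GRing.isLinear.Build K {malg K[X]} W _ linext linext_is_linear.

End LinearExtension.

Section LocalitySpaces.
Variable K : fieldType.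

Definition polar (V : lmodType K) (top : V -> V -> Prop) (U : set V) : set V :=
  [set x | forall u, U u -> top x u].

Definition locality_space (V : lmodType K) (top : V -> V -> Prop) : Prop :=
  [/\ forall x y, top x y -> top y x,
      top 0 0 &
      forall U : set V, is_subspace (polar top U)].

Definition locality_linear (V W : lmodType K)
    (topV : V -> V -> Prop) (topW : W -> W -> Prop) (h : V -> W) : Prop :=
  linear h /\ forall x y, topV x y -> topW (h x) (h y).

Definition locality_compatible (V : lmodType K) (top : V -> V -> Prop)
    (W : set V) : Prop :=
  forall x y z w, W w -> top x y -> top (x + w) z ->
    exists w', [/\ W w', top (x + w') y & top (x + w') z].

End LocalitySpaces.

(* Tuples over V of arbitrary length are words, i.e. elements of the free monoid
   {fmonom V}, so that {malg K[{fmonom V}]} is the direct sum over k of the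
   spaces K(V^k), with the concatenation product. *)
Section Tensor.
Variables (K : fieldType) (V : lmodType K).

Definition tup (s : seq V) : {malg K[{fmonom V}]} := << FMonom s >>.

Definition mult_gen (k : nat) : set {malg K[{fmonom V}]} :=
  [set t | (exists s1 s2 a b, (size s1 + size s2).+1 = k /\
              t = tup (s1 ++ (a + b) :: s2)
                  - tup (s1 ++ a :: s2) - tup (s1 ++ b :: s2))
        \/ (exists s1 s2 x (c : K), (size s1 + size s2).+1 = k /\
              t = tup (s1 ++ (c *: x) :: s2) - c *: tup (s1 ++ x :: s2))].

Definition Imult (k : nat) : subspace {malg K[{fmonom V}]} :=
  span (mult_gen k).

Definition Imult_upto (n : nat) : subspace {malg K[{fmonom V}]} :=
  span [set t | exists k, (1 <= k <= n)%N /\ Imult k t].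

Definition Imult_all : subspace {malg K[{fmonom V}]} :=
  span [set t | exists k, (1 <= k)%N /\ Imult k t].

Variable top : V -> V -> Prop.

Definition indep (s : seq V) : Prop :=
  forall i j, (i < size s)%N -> (j < size s)%N -> i <> j -> top s`_i s`_j.

Lemma indep_nil : indep [::].
Proof. by []. Qed.

Lemma indep_seq1 x : indep [:: x].
Proof. by move=> [|i] [|j]. Qed.

(* The disjoint union over k of the sets of pairwise independent k-tuples. *)
Definition lword := {w : {fmonom V} | `[< indep w >]}.

Definition lword_nil : lword :=
  exist _ (FMonom [::]) (introT (asboolP _) indep_nil).
Definition lword1 (x : V) : lword :=
  exist _ (FMonom [:: x]) (introT (asboolP _) (@indep_seq1 x)).

(* The union of all F^n(V); the basis element 1 is the empty word. *)
Definition Ftens : lmodType K := {malg K[lword]}.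

Definition Fincl (t : Ftens) : {malg K[{fmonom V}]} :=
  linext (fun w : lword => << val w >> : {malg K[{fmonom V}]}) t.

Definition Fupto (n : nat) : set Ftens :=
  [set t : Ftens | forall w : lword, w \in msupp t -> (size (val w) <= n)%N].

(* The relation top_x^n; it is a relation on F^n(V), so it is given the
   field F^n(V) when seen as a relation on Ftens. *)
Definition topF (n : nat) (s t : Ftens) : Prop :=
  [/\ Fupto n s, Fupto n t &
      forall w w' : lword, w \in msupp s -> w' \in msupp t ->
        forall x y, x \in (val w : seq V) -> y \in (val w' : seq V) -> top x y].

Definition ImultF_upto (n : nat) : set Ftens :=
  [set t | Fupto n t /\ Imult_upto n (Fincl t)].

Lemma ImultF_is_subspace : is_subspace [set t : Ftens | Imult_all (Fincl t)].
Proof.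
case: (subspaceP Imult_all) => I0 ID.
by split=> [|c x y hx hy]; rewrite /= /Fincl (linear0, linearP) //; exact: ID.
Qed.

Definition ImultF : subspace Ftens := Subspace ImultF_is_subspace.

Definition tensor_alg : lmodType K := vquot ImultF.

Definition tensor_top (x y : tensor_alg) : Prop :=
  exists n a b, [/\ topF n a b, x = vproj ImultF a & y = vproj ImultF b].

(* The graph of the product: [tensor_mul x y z] says that x and y are related
   and that z is their tensor product. *)
Definition tensor_mul (x y z : tensor_alg) : Prop :=
  exists n a b c, [/\ topF n a b, x = vproj ImultF a, y = vproj ImultF b,
    z = vproj ImultF c & Fincl c = Fincl a * Fincl b].

Definition tensor_unit (c : K) : tensor_alg :=
  vproj ImultF (c *: (<< lword_nil >> : Ftens)).

Definition tensor_iota (x : V) : tensor_alg :=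
  vproj ImultF (<< lword1 x >> : Ftens).

End Tensor.

Arguments topF {K V} top n s t.
Arguments ImultF_upto {K V} top n.
Arguments tensor_top {K V} top x y.
Arguments tensor_mul {K V} top x y z.

(* A partial product with domain top is represented by a total function whose
   values off top play no role. *)
Section LocalityAlgebras.
Variable K : fieldType.

Definition locality_bilinear (A : lmodType K) (top : A -> A -> Prop)
    (m : A -> A -> A) : Prop :=
  forall t : {malg K[{fmonom A}]},
    Imult A 2 t -> (forall w, w \in msupp t -> indep top w) ->
    linext (fun w : {fmonom A} => m w`_0 w`_1) t = 0.

Definition polar_stable (A : lmodType K) (top : A -> A -> Prop)
    (m : A -> A -> A) : Prop :=
  forall (U : set A) x y,
    polar top U x -> polar top U y -> top x y -> polar top U (m x y).

Definition locality_algebra (A : lmodType K) (top : A -> A -> Prop)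
    (m : A -> A -> A) (u : K -> A) : Prop :=
  locality_space top /\
  locality_bilinear top m /\
  (forall x y z, top x y -> top y z -> top x z ->
     top (m x y) z -> top x (m y z) -> m (m x y) z = m x (m y z)) /\
  polar_stable top m /\
  linear (u : K^o -> A) /\
  (forall c a, top (u c) a) /\
  (forall c a, m (u c) a = c *: a /\ m a (u c) = c *: a).

Definition locality_lie_algebra (g : lmodType K) (top : g -> g -> Prop)
    (br : g -> g -> g) : Prop :=
  locality_space top /\
  locality_bilinear top br /\
  (forall a b a' b', top a b -> top a' b' -> top a a' -> top b b' ->
     top (br a b) (br a' b')) /\
  (forall x y, top x y -> br x y = - br y x) /\
  polar_stable top br /\
  (forall a b c, top a b -> top b c -> top a c ->
     br a (br b c) + br b (br c a) + br c (br a b) = 0).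

Definition commutator (A : lmodType K) (m : A -> A -> A) (x y : A) : A :=
  m x y - m y x.

Definition locality_lie_morphism (g h : lmodType K)
    (topg : g -> g -> Prop) (brg : g -> g -> g)
    (toph : h -> h -> Prop) (brh : h -> h -> h) (f : g -> h) : Prop :=
  locality_linear topg toph f /\
  forall x y, topg x y -> f (brg x y) = brh (f x) (f y).

Definition graph (A : lmodType K) (top : A -> A -> Prop) (m : A -> A -> A)
    (x y z : A) : Prop := top x y /\ z = m x y.

(* The products are given by their graphs: the induced product of a quotient is
   only a relation a priori. *)
Definition locality_algebra_morphism (A B : lmodType K)
    (topA : A -> A -> Prop) (mulA : A -> A -> A -> Prop) (uA : K -> A)
    (topB : B -> B -> Prop) (mulB : B -> B -> B -> Prop) (uB : K -> B)
    (h : A -> B) : Prop :=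
  [/\ locality_linear topA topB h,
      forall x y z, mulA x y z -> mulB (h x) (h y) (h z) &
      forall c, h (uA c) = uB c].

Definition prelocality_ideal (A : lmodType K) (top : A -> A -> Prop)
    (mul : A -> A -> A -> Prop) (I : set A) : Prop :=
  is_subspace I /\
  forall x y z, I x -> polar top I y -> mul x y z \/ mul y x z -> I z.

End LocalityAlgebras.

Section Enveloping.
Variables (K : fieldType) (g : lmodType K).
Variables (top : g -> g -> Prop) (br : g -> g -> g).

(* The elements a (x) b - b (x) a - [a, b] of the tensor algebra. *)
Definition lie_gens : set (tensor_alg top) :=
  [set x | exists a b (t : Ftens top), [/\ top a b, x = vproj (ImultF top) t &
     Fincl t = tup [:: a; b] - tup [:: b; a] - tup [:: br a b]]].

Lemma Jlie_is_subspace : is_subspace [set x | forall I : set (tensor_alg top),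
  prelocality_ideal (tensor_top top) (tensor_mul top) I ->
  lie_gens `<=` I -> I x].
Proof.
split=> [I [[]]|c x y hx hy I hI hg] //.
by case: (hI) => [[_ ID] _]; apply: ID; [exact: hx | exact: hy].
Qed.

(* The ideal generated by lie_gens, as the intersection of all (pre-)locality
   ideals containing it. *)
Definition Jlie : subspace (tensor_alg top) := Subspace Jlie_is_subspace.

Definition envel : lmodType K := vquot Jlie.

Definition envel_top (x y : envel) : Prop :=
  exists a b, [/\ tensor_top top a b, x = vproj Jlie a & y = vproj Jlie b].

(* The induced product, as the image of the graph of the product of the tensor
   algebra. Jlie absorbs products with elements of its polar only, so this
   relation need not be functional. *)
Definition envel_mul (x y z : envel) : Prop :=
  exists a b c, [/\ tensor_mul top a b c, x = vproj Jlie a, y = vproj Jlie b &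
                    z = vproj Jlie c].

Definition envel_unit (c : K) : envel := vproj Jlie (tensor_unit top c).

Definition iota_lie (x : g) : envel := vproj Jlie (tensor_iota top x).

End Enveloping.

Arguments envel_top {K g} top br x y.
Arguments envel_mul {K g} top br x y z.
Arguments envel_unit {K g} top br c.
Arguments iota_lie {K g} top br x.

(* Main.v *)
Require Import Defs.
From HB Require Import structures.
From mathcomp Require Import all_boot all_order all_algebra.
From mathcomp Require Import boolp classical_sets.
From mathcomp Require Import finmap monalg.

Set Implicit Arguments.
Unset Strict Implicit.
Unset Printing Implicit Defensive.

Import GRing.Theory.

(** The bracket relations are the only ones imposed by the quotient, so a
    morphism out of the enveloping algebra is the same thing as a morphism
    out of the tensor algebra that turns brackets into commutators. On a
    word x1 ... xk of pairwise independent letters the only possible value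
    is the iterated product f x1 (f x2 (... (f xk 1))), because such a word
    is a product of its letters in the enveloping algebra. This gives
    uniqueness ([envel_morphism_unique]); it also says which map to
    construct.

    The crux is that this assignment is well defined on the tensor algebra:
    a combination of independent k-words may vanish in the k-th tensor power
    because of multilinear relations that pass through words with dependent
    letters, where no product in the target is available. The axiom of the
    locality algebra A excludes this trouble only for k = 2. The passage to
    all k is by induction. Suppose that the iterated product on independent
    k-words has been extended to a multilinear map P on all k-words. Applied
    to all letters of a (k+1)-word but the first, P turns a multilinear
    relation between (k+1)-words into one between pairs (f x, P s) of
    elements of A. When the words of the relation are independent, these
    pairs are related in A, and the case k = 2 applies ([word_image_Imult]).
    So the iterated product vanishes on all combinations of independent
    (k+1)-words that are zero in the tensor power, hence is a well defined
    linear map on a subspace of the (k+1)-st tensor power of the whole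
    space; Zorn's lemma extends it to the whole tensor power, which is the
    next P ([multilinear_extension_size]).

    The rest is formal. Locality of the resulting map follows from the fact
    that polars are subspaces stable under products, multiplicativity from
    associativity on independent elements ([wprod_cat]). The kernel of a
    morphism on the tensor algebra is a locality ideal, and it contains the
    generators of the ideal of bracket relations because f is a Lie
    morphism, so the map descends to the quotient ([Jlie_kernel]). *)

(** * Extension of linear maps defined on a subspace *)

Section LinearMaps.
Local Open Scope ring_scope.
Local Open Scope classical_set_scope.
Variable K : fieldType.

Lemma linear_bundle (E F : lmodType K) (h : E -> F) :
  linear h -> exists h' : {linear E -> F}, h' = h :> (E -> F).
Proof.
move=> hl.
pose b := GRing.isLinear.Build K E F _ h hl.
by exists (HB.pack_for {linear E -> F} h b).
Qed.

Lemma span_sub (E : lmodType K) (S W : set E) :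
  is_subspace W -> S `<=` W -> Defs.span S `<=` W.
Proof. by move=> hW hS x /(_ (Subspace hW) hS). Qed.

Lemma preimage_is_subspace (E F : lmodType K) (h : {linear E -> F})
    (W : set F) : is_subspace W -> is_subspace [set x | W (h x)].
Proof.
move=> [W0 WD]; split=> [|c x y hx hy] /=; first by rewrite linear0.
by rewrite linearP; exact: WD.
Qed.

Lemma kernel_is_subspace (E F : lmodType K) (h : {linear E -> F}) :
  is_subspace [set x | h x = 0].
Proof.
split=> [|c x y /= hx hy] /=; first by rewrite linear0.
by rewrite linearP hx hy scaler0 addr0.
Qed.

Lemma subspaceB (E : lmodType K) (W : set E) x y :
  is_subspace W -> W x -> W y -> W (x - y).
Proof. by move=> [_ WD] Wx Wy; rewrite addrC -scaleN1r; exact: WD. Qed.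

Lemma subspaceZ (E : lmodType K) (W : set E) c x :
  is_subspace W -> W x -> W (c *: x).
Proof. by move=> [W0 WD] Wx; rewrite -[_ *: _]addr0; exact: WD. Qed.

(** [linear_graph G] says that G is the graph of a linear map defined on
    some subspace of E. Working with graphs makes partial maps ordered by
    inclusion. *)
Definition linear_graph (E F : lmodType K) (G : set (E * F)) : Prop :=
  is_subspace (G : set (E * F)%type) /\ forall y, G (0, y) -> y = 0.

Lemma linear_graph_functional (E F : lmodType K) (G : set (E * F)) x y y' :
  linear_graph G -> G (x, y) -> G (x, y') -> y = y'.
Proof.
move=> [Gs G0] h h'; apply/eqP; rewrite -subr_eq0; apply/eqP; apply: G0.
have := subspaceB Gs h h'.
by rewrite /GRing.add/= /GRing.opp /= /add_pair /= subrr.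
Qed.

(** Zorn's lemma is applied to the sets H whose union with G is still a
    graph, rather than to the graphs containing G, so that the union of the
    empty chain needs no separate treatment. *)
Lemma linear_graph_extension (E F : lmodType K) (G : set (E * F)) :
  linear_graph G -> exists h : {linear E -> F}, forall x y, G (x, y) -> y = h x.
Proof.
move=> hG.
have [C hC tC|H [hH Hmax]] := @Zorn_bigcup _ [set H | linear_graph (G `|` H)].
  split; last first.
    move=> y [Gy|[X CX Xy]]; first by case: hG => _; apply.
    by case: (hC _ CX) => _; apply; right.
  split=> [|c p q]; first by left; case: hG => -[].
  have step X : C X -> (G `|` X) p -> (G `|` X) q ->
      (G `|` \bigcup_(Y in C) Y) (c *: p + q).
    move=> CX hp hq; case: (hC _ CX) => -[_ /(_ c p q hp hq) XD] _.
    by case: XD => XD; [left | right; exists X].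
  move=> [Gp|[X CX Xp]] [Gq|[Y CY Yq]].
  - by left; case: hG => -[_ GD] _; exact: GD.
  - by apply: (step Y) => //; [left|right].
  - by apply: (step X) => //; [right|left].
  - have [XY|YX] := tC _ _ CX CY.
      by apply: (step Y) => //; right => //; exact: XY.
    by apply: (step X) => //; right => //; exact: YX.
set H' := G `|` H in hH.
have [[H0 HD] Hf] := hH.
(* A maximal graph is total: off its domain, the value 0 at x extends it. *)
have dom x : exists y, H' (x, y).
  apply: contrapT => hx.
  pose B : set (E * F) := [set p | exists q c, H' q /\ p = q + (c *: x, 0)].
  have H'B : H' `<=` B.
    move=> p H'p; exists p, 0; split => //.
    by rewrite scale0r -[(0, 0)]/(0 : E * F)%R addr0.
  have GBE : G `|` B = B.
    by apply/seteqP; split=> p; [case=> // Gp; apply: H'B; left | right].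
  apply: (Hmax B).
    split; first by move=> p Hp; apply: H'B; right.
    move=> BH; apply: hx; exists 0; right; apply: BH.
    exists 0, 1; split => //.
    by rewrite add0r scale1r.
  rewrite /= GBE; split; first split.
  - by exact: H'B.
  - move=> c _ _ [q [d [Hq ->]]] [q' [d' [Hq' ->]]].
    exists (c *: q + q'), (c * d + d'); split; first exact: HD.
    rewrite scalerDr addrACA; congr (_ + _).
    have e : (c *: (d *: x) + d' *: x, c *: 0 + 0) =
             ((c * d + d') *: x, 0) :> E * F.
      by rewrite scaler0 addr0 scalerA -scalerDl.
    exact: e.
  - move=> y [[q1 q2] [c [Hq [e1 e2]]]].
    rewrite addr0 in e2; rewrite e2.
    have [c0|c0] := eqVneq c 0.
      move: e1; rewrite c0 scale0r addr0 => e1; apply: Hf.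
      by rewrite e1.
    exfalso; apply: hx; exists (- c^-1 *: q2).
    have -> : x = - c^-1 *: q1.
      have -> : q1 = - (c *: x) by apply/eqP; rewrite -addr_eq0 -e1.
      by rewrite scalerN scaleNr opprK scalerA mulVf // scale1r.
    exact: (subspaceZ (- c^-1) (conj H0 HD) Hq).
have [h hh] := choice dom.
have hl : linear h.
  move=> c x y; apply: (linear_graph_functional hH (hh _)).
  exact: (HD c _ _ (hh x) (hh y)).
have [h' h'E] := linear_bundle hl.
exists h' => x y Gxy; rewrite h'E; apply: (linear_graph_functional hH _ (hh _)).
by left.
Qed.

End LinearMaps.

(** * Linear extension on free spaces *)

Section FreeSpaces.
Local Open Scope ring_scope.
Local Open Scope classical_set_scope.
Variable K : fieldType.

Lemma linext1 (X : choiceType) (W : lmodType K) (h : X -> W) k :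
  linext h << k >> = h k.
Proof. by rewrite /linext msuppU oner_eq0 big_seq_fset1 mcoeffUU scale1r. Qed.

Lemma scale_malg1 (X : choiceType) c (k : X) :
  c *: << k >> = << c *g k >> :> {malg K[X]}.
Proof. by apply/malgP => k'; rewrite mcoeffZ !mcoeffU mulrnAr mulr1. Qed.

Lemma malg_basis_sum (X : choiceType) (t : {malg K[X]}) :
  t = \sum_(k <- msupp t) t@_k *: << k >>.
Proof.
by rewrite {1}[t]monalgE; apply: eq_bigr => k _; rewrite scale_malg1.
Qed.

Lemma linear_linext (X : choiceType) (V W : lmodType K) (h : {linear V -> W})
    (b : X -> V) t : h (linext b t) = linext (h \o b) t.
Proof.
by rewrite /linext linear_sum; apply: eq_bigr => k _; rewrite linearZ.
Qed.

Lemma eq_in_linext (X : choiceType) (W : lmodType K) (h h' : X -> W) t :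
  {in msupp t, h =1 h'} -> linext h t = linext h' t.
Proof.
move=> hh'; rewrite /linext !big_seq; apply: eq_bigr => k kt.
by rewrite hh'.
Qed.

Lemma linext_in_subspace (X : choiceType) (V : lmodType K) (W : set V)
    (b : X -> V) t :
  is_subspace W -> (forall k, k \in msupp t -> W (b k)) -> W (linext b t).
Proof.
move=> hW hb; rewrite /linext big_seq; apply: big_ind => [|x y|k kt].
- by case: hW.
- by case: (hW) => _ WD hx hy; rewrite -[x]scale1r; exact: WD.
- by apply: subspaceZ => //; exact: hb.
Qed.

Lemma supported_is_subspace (X : choiceType) (S : set X) :
  is_subspace [set t : {malg K[X]} | forall k, k \in msupp t -> S k].
Proof.
split=> [k|c s t hs ht k]; first by rewrite msupp0.
move=> /(fsubsetP (msuppD_le _ _)); rewrite in_fsetU => /orP[|/ht //].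
by move=> /(fsubsetP (msuppZ_le _ _)) /hs.
Qed.

Lemma supported1 (X : choiceType) (S : set X) k :
  S k -> forall k', k' \in msupp (<< k >> : {malg K[X]}) -> S k'.
Proof. by move=> Sk k'; rewrite msuppU oner_eq0 inE => /eqP ->. Qed.

End FreeSpaces.

(** * Independent words and multilinear relations *)

Section Independence.
Variables (K : fieldType) (V : lmodType K) (top : V -> V -> Prop).
Hypothesis topC : forall x y, top x y -> top y x.

Lemma indep_cons x s :
  indep top (x :: s) <-> (forall y, y \in s -> top x y) /\ indep top s.
Proof.
split=> [h|[hx hs] [|i] [|j] //=].
- split=> [y /(nthP 0%R) [i si <-]|i j si sj ij].
    exact: (h 0 i.+1).
  by apply: (h i.+1 j.+1) => // -[].
- by move=> _ sj _; apply/hx/mem_nth.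
- by move=> si _ _; apply/topC/hx/mem_nth.
- by move=> si sj ij; apply: hs => // e; apply: ij; rewrite e.
Qed.

Lemma indep_cat s1 s2 :
  indep top s1 -> indep top s2 ->
  (forall x y, x \in s1 -> y \in s2 -> top x y) -> indep top (s1 ++ s2).
Proof.
move=> + h2; elim: s1 => //= x s1 IH /indep_cons [hx h1] h12.
apply/indep_cons; split=> [y|].
  by rewrite mem_cat => /orP[/hx //|ys2]; apply: h12; rewrite ?mem_head.
by apply: IH => // y z ys zs; apply: h12; rewrite // in_cons ys orbT.
Qed.

Lemma indep_cat_inv s1 s2 :
  indep top (s1 ++ s2) -> indep top s1 /\ indep top s2 /\
    forall x y, x \in s1 -> y \in s2 -> top x y.
Proof.
elim: s1 => [|x s1 IH] /=; first by move=> h; split; [exact: indep_nil|].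
move=> /indep_cons [hx /IH [h1 [h2 h12]]].
split.
  by apply/indep_cons; split => // y ys1; apply: hx; rewrite mem_cat ys1.
split => // y z; rewrite in_cons => /predU1P[->|ys1] zs2; last exact: h12.
by apply: hx; rewrite mem_cat zs2 orbT.
Qed.

Lemma indep_seq2 x y : top x y -> indep top [:: x; y].
Proof.
move=> xy; apply/indep_cons; split=> [z|]; first by rewrite inE => /eqP ->.
exact: indep_seq1.
Qed.

End Independence.

Section Multilinearity.
Local Open Scope ring_scope.
Local Open Scope classical_set_scope.
Variables (K : fieldType) (V : lmodType K).

Lemma linext_tup (W : lmodType K) (h : {fmonom V} -> W) s :
  linext h (tup s) = h (FMonom s).
Proof. exact: linext1. Qed.

Lemma Imult_add (s1 s2 : seq V) a b :
  Imult V (size s1 + size s2).+1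
    (tup (s1 ++ (a + b) :: s2) - tup (s1 ++ a :: s2) - tup (s1 ++ b :: s2)).
Proof. by move=> W; apply; left; exists s1, s2, a, b. Qed.

Lemma Imult_scale (s1 s2 : seq V) (c : K) a :
  Imult V (size s1 + size s2).+1
    (tup (s1 ++ (c *: a) :: s2) - c *: tup (s1 ++ a :: s2)).
Proof. by move=> W; apply; right; exists s1, s2, a, c. Qed.

Lemma Imult_slot_linear (s1 s2 : seq V) (c : K) a b :
  Imult V (size s1 + size s2).+1
    (tup (s1 ++ (c *: a + b) :: s2)
     - (c *: tup (s1 ++ a :: s2) + tup (s1 ++ b :: s2))).
Proof.
have [_ ID] := subspaceP (Imult V (size s1 + size s2).+1).
set p := tup (_ ++ (_ + _) :: _); set q := tup (s1 ++ a :: s2).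
set r := tup (s1 ++ b :: s2); pose q' := tup (s1 ++ (c *: a) :: s2).
(* Split the slot as a sum first, then take the scalar out of its first term. *)
have -> : p - (c *: q + r) = 1 *: (p - q' - r) + (q' - c *: q).
  by rewrite opprD addrA scale1r [RHS]addrAC addrA subrK.
by apply: ID; [exact: Imult_add | exact: Imult_scale].
Qed.

End Multilinearity.

(** * Iterated products in a locality algebra *)

Section WordProducts.
Local Open Scope ring_scope.
Local Open Scope classical_set_scope.
Variables (K : fieldType) (A : lmodType K) (top : A -> A -> Prop).
Variables (m : A -> A -> A) (u : K -> A).
Hypothesis hA : locality_algebra top m u.

Lemma alg_topC x y : top x y -> top y x.
Proof. by case: hA => -[+ _ _] _; apply. Qed.

Lemma polar_subspace (U : set A) : is_subspace (polar top U).
Proof. by case: hA => -[_ _ +] _; apply. Qed.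

Lemma top_lin c x y z : top x z -> top y z -> top (c *: x + y) z.
Proof.
move=> xz yz; have [_ /(_ c x y) h] := polar_subspace [set z].
by apply: h => // _ ->.
Qed.

Lemma top0 x : top 0 x.
Proof. by have [h _] := polar_subspace setT; exact: h. Qed.

Lemma top_mul x y z : top x y -> top x z -> top y z -> top (m x y) z.
Proof.
case: hA => _ [_ [_ [hp _]]] xy xz yz.
by apply: (hp [set z] x y) => // _ ->.
Qed.

Lemma top_unit c x : top (u c) x.
Proof. by case: hA => _ [_ [_ [_ [_ [h _]]]]]. Qed.

Lemma mul_bilinear t :
  Imult A 2 t -> (forall w, w \in msupp t -> indep top w) ->
  linext (fun w : {fmonom A} => m (w : seq A)`_0 (w : seq A)`_1) t = 0.
Proof. by case: hA => _ [+ _]; apply. Qed.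

(** Bilinearity of the partial product in either of its two arguments,
    treated at once: one of s1, s2 is empty and the other holds the fixed
    argument. *)
Lemma mul_slot_linear (s1 s2 : seq A) c a b :
  (size s1 + size s2).+1 = 2 ->
  (forall x, x \in [:: c *: a + b; a; b] -> indep top (s1 ++ x :: s2)) ->
  let M s := m s`_0 s`_1 in
  M (s1 ++ (c *: a + b) :: s2) = c *: M (s1 ++ a :: s2) + M (s1 ++ b :: s2).
Proof.
move=> s12 ind M; have := @Imult_slot_linear K A s1 s2 c a b; rewrite s12.
move=> /mul_bilinear h; apply/eqP; rewrite -subr_eq0; apply/eqP.
rewrite -[RHS]h; last first.
  have hS := @supported_is_subspace K _ (fun w : {fmonom A} => indep top w).
  apply: (subspaceB hS); last apply: (proj2 hS).
  - by apply: supported1; apply: ind; rewrite !inE eqxx.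
  - by apply: supported1; apply: ind; rewrite !inE eqxx orbT.
  - by apply: supported1; apply: ind; rewrite !inE eqxx !orbT.
rewrite [in RHS](linearB (linext _)) [in RHS](linearP (linext _)) /=.
by rewrite !linext_tup.
Qed.

Lemma mulDr c x y z :
  top x y -> top x z -> m x (c *: y + z) = c *: m x y + m x z.
Proof.
move=> xy xz; apply: (@mul_slot_linear [:: x] [::]) => // w.
rewrite !inE => /or3P[] /eqP -> /=; apply: (indep_seq2 alg_topC) => //.
by apply: alg_topC; apply: top_lin; exact: alg_topC.
Qed.

Lemma mulDl c x y z :
  top x z -> top y z -> m (c *: x + y) z = c *: m x z + m y z.
Proof.
move=> xz yz; apply: (@mul_slot_linear [::] [:: z]) => // w.
rewrite !inE => /or3P[] /eqP -> /=; apply: (indep_seq2 alg_topC) => //.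
exact: top_lin.
Qed.

Lemma mul0l x : m 0 x = 0.
Proof.
have := mulDl 1 (top0 x) (top0 x).
rewrite !scale1r addr0 => /eqP.
by rewrite -subr_eq0 opprD addNKr oppr_eq0 => /eqP.
Qed.

Lemma mul0r x : m x 0 = 0.
Proof.
have x0 := alg_topC (top0 x); have := mulDr 1 x0 x0.
rewrite !scale1r addr0 => /eqP.
by rewrite -subr_eq0 opprD addNKr oppr_eq0 => /eqP.
Qed.

Fixpoint wprod (s : seq A) : A := if s is x :: s' then m x (wprod s') else u 1.

(** The iterated products involved are all defined, since x and the tail of the
    word stay related: polars are stable under products. *)
Lemma top_wprod s x :
  indep top s -> (forall y, y \in s -> top y x) -> top (wprod s) x.
Proof.
elim: s x => [|y s IH] x /=; first by move=> _ _; exact: top_unit.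
move=> /(indep_cons alg_topC)[ys hs] h; apply: top_mul.
- apply: alg_topC; apply: IH => // z zs; exact/alg_topC/ys.
- by apply: h; rewrite mem_head.
- by apply: IH => // z zs; apply: h; rewrite in_cons zs orbT.
Qed.

Lemma mul_unitl x : m (u 1) x = x.
Proof.
by case: hA => _ [_ [_ [_ [_ [_ /(_ 1 x)[-> _]]]]]]; rewrite scale1r.
Qed.

Lemma mul_unitr x : m x (u 1) = x.
Proof.
by case: hA => _ [_ [_ [_ [_ [_ /(_ 1 x)[_ ->]]]]]]; rewrite scale1r.
Qed.

Lemma unitZ c : u c = c *: u 1.
Proof.
case: hA => _ [_ [_ [_ [/linear_bundle[u' u'E] _]]]].
by rewrite -[u]u'E -linearZ /= /GRing.scale /= mulr1.
Qed.

(** Associativity in A is available only for pairwise independent elements whose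
    products are still related; both conditions come from [top_wprod]. *)
Lemma wprod_cat s1 s2 :
  indep top (s1 ++ s2) -> wprod (s1 ++ s2) = m (wprod s1) (wprod s2).
Proof.
elim: s1 => [|x s1 IH] /=; first by rewrite mul_unitl.
move=> /(indep_cons alg_topC)[hx h12]; rewrite IH //.
have [h1 [h2 hc]] : indep top s1 /\ indep top s2 /\
    forall y z, y \in s1 -> z \in s2 -> top y z.
  by exact: (indep_cat_inv alg_topC).
have xs1 : top x (wprod s1).
  apply/alg_topC/top_wprod => // y ys1; apply/alg_topC/hx.
  by rewrite mem_cat ys1.
have xs2 : top x (wprod s2).
  apply/alg_topC/top_wprod => // y ys2; apply/alg_topC/hx.
  by rewrite mem_cat ys2 orbT.
have s12 : top (wprod s1) (wprod s2).
  apply: top_wprod => // y ys1; apply/alg_topC/top_wprod => // z zs2.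
  exact/alg_topC/hc.
case: hA => _ [_ [massoc _]]; rewrite massoc //; first exact: top_mul.
by apply/alg_topC/top_mul => //; exact: alg_topC.
Qed.

End WordProducts.

(** * Well-definedness on locality tensor powers *)

Section MultilinearExtension.
Local Open Scope ring_scope.
Local Open Scope classical_set_scope.
Variables (K : fieldType) (V A : lmodType K).
Variables (topV : V -> V -> Prop) (top : A -> A -> Prop).
Variables (m : A -> A -> A) (u : K -> A) (f : V -> A).
Hypothesis hA : locality_algebra top m u.
Hypothesis topVC : forall x y, topV x y -> topV y x.
Hypothesis hf : locality_linear topV top f.

Definition word_image (s : seq V) : A := wprod m u (map f s).

Lemma indep_map s : indep topV s -> indep top (map f s).
Proof.
elim: s => [|x s IH] //= /(indep_cons topVC)[hx hs].
apply/(indep_cons (alg_topC hA)); split=> [_ /mapP[y ys ->]|]; last exact: IH.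
by case: hf => _; apply; exact: hx.
Qed.

Lemma top_word_image s s' :
  indep topV s -> indep topV s' ->
  (forall x y, x \in s -> y \in s' -> topV x y) ->
  top (word_image s) (word_image s').
Proof.
move=> hs hs' ss'; apply: (top_wprod hA) => [|_ /mapP[x xs ->]].
  exact: indep_map.
apply/(alg_topC hA)/(top_wprod hA) => [|_ /mapP[y ys' ->]].
  exact: indep_map.
by case: hf => _; apply; apply/topVC/ss'.
Qed.

(** Words carry no length in their type; the length k is a parameter so that the
    induction can treat one tensor power at a time. *)
Definition multilinear k (P : seq V -> A) : Prop :=
  forall s1 s2, (size s1 + size s2).+1 = k ->
    linear (fun x => P (s1 ++ x :: s2)).

Lemma linext_Imult k P t :
  multilinear k P -> Imult V k t -> linext (fun w : {fmonom V} => P w) t = 0.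
Proof.
move=> hP; pose h := linext (fun w : {fmonom V} => P w).
apply: (@span_sub _ _ _ [set t | h t = 0]); first exact: kernel_is_subspace.
rewrite /h.
move=> {}t [[s1 [s2 [a [b [sk ->]]]]]|[s1 [s2 [a [c [sk ->]]]]]] /=.
  rewrite 2!(linearB (linext _)) /= !linext_tup /=.
  have := hP s1 s2 sk 1 a b; rewrite !scale1r => ->.
  by rewrite addrAC addrK subrr.
rewrite (linearB (linext _)) (linearZ_LR (linext _)) /= !linext_tup /=.
have [P' P'E] := linear_bundle (hP s1 s2 sk).
have /= := linearZ_LR P' c a; rewrite P'E => ->.
by rewrite subrr.
Qed.

(** This is the map f times P from words of length k+1 to pairs in A, which
    reduces multilinear relations in k+1 variables to bilinear ones. *)
Definition cons_pair (P : seq V -> A) (w : {fmonom V}) : {malg K[{fmonom A}]} :=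
  if w : seq V is x :: s then tup [:: f x; P s] else 0.

(** A relation in the first slot becomes one in the first entry of the pair
    by linearity of f, a relation in a later slot becomes one in the second
    entry by multilinearity of P. The words of a relation may have dependent
    letters, which is why P has to be defined on all words. *)
Lemma cons_pair_Imult k P t :
  multilinear k P -> Imult V k.+1 t -> Imult A 2 (linext (cons_pair P) t).
Proof.
move=> hP; pose h := linext (cons_pair P).
apply: (@span_sub _ _ _ [set t | Imult A 2 (h t)]).
  by apply: (preimage_is_subspace h); exact: subspaceP.
rewrite /h.
have [f' f'E] := linear_bundle (proj1 hf).
have fD a b : f (a + b) = f a + f b by rewrite -f'E linearD.
have fZ c a : f (c *: a) = c *: f a by rewrite -f'E linearZ_LR.
move=> {}t [[s1 [s2 [a [b [sk ->]]]]]|[s1 [s2 [a [c [sk ->]]]]]] /=.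
  rewrite 2!(linearB (linext _)) /= !linext_tup.
  case: s1 sk => [|x s1] [sk].
    rewrite /cons_pair /= fD.
    exact: (@Imult_add K A [::] [:: P s2] (f a) (f b)).
  have := hP s1 s2 sk 1 a b; rewrite !scale1r => E.
  rewrite /cons_pair /= E.
  exact: (@Imult_add K A [:: f x] [::] (P (s1 ++ a :: s2)) (P (s1 ++ b :: s2))).
rewrite (linearB (linext _)) (linearZ_LR (linext _)) /= !linext_tup.
case: s1 sk => [|x s1] [sk].
  rewrite /cons_pair /= fZ.
  exact: (@Imult_scale K A [::] [:: P s2] c (f a)).
have [P' P'E] := linear_bundle (hP s1 s2 sk).
have /= E := linearZ_LR P' c a; rewrite P'E in E.
rewrite /cons_pair /= E.
exact: (@Imult_scale K A [:: f x] [::] c (P (s1 ++ a :: s2))).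
Qed.

(** Pairs coming from independent words are related in A, so the bilinearity
    axiom of A applies to the image of t under [cons_pair P]; on these
    pairs, the product of A gives back the iterated product of the word. *)
Lemma word_image_Imult k P t :
  multilinear k P ->
  (forall s, size s = k -> indep topV s -> P s = word_image s) ->
  Imult V k.+1 t ->
  (forall w, w \in msupp t -> size (w : seq V) = k.+1 /\ indep topV w) ->
  linext (fun w : {fmonom V} => word_image w) t = 0.
Proof.
move=> hP PE tI tS.
have supp : forall w, w \in msupp (linext (cons_pair P) t) -> indep top w.
  pose W := [set t' : {malg K[{fmonom A}]} |
    forall w, w \in msupp t' -> indep top w].
  apply: (@linext_in_subspace K _ _ W); first exact: supported_is_subspace.
  move=> [[|x s]] /tS[//= [sk] /(indep_cons topVC)[hx hs]].
  apply: supported1; apply: (indep_seq2 (alg_topC hA)).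
  rewrite PE // -[f x](mul_unitr hA).
  apply: (@top_word_image [:: x]) => //; first exact: indep_seq1.
  by move=> y z; rewrite inE => /eqP ->; exact: hx.
have := mul_bilinear hA (cons_pair_Imult hP tI) supp.
rewrite (linear_linext (linext _)) => <-.
apply: eq_in_linext => -[[|x s]] /tS[//= [sk] /(indep_cons topVC)[hx hs]].
by rewrite linext_tup /= PE.
Qed.

(** The map to extend sends t + v to the iterated product of t, for t a
    combination of independent words and v a multilinear relation. It is well
    defined by the previous lemma, and any extension vanishes on multilinear
    relations, that is, it is multilinear. *)
Lemma multilinear_extension_size k :
  exists P, multilinear k P /\
    forall s, size s = k -> indep topV s -> P s = word_image s.
Proof.
elim: k => [|k [P [hP PE]]].
  by exists (fun=> u 1); split=> // -[].
pose S := [set t : {malg K[{fmonom V}]} | forall w, w \in msupp t ->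
  size (w : seq V) = k.+1 /\ indep topV w].
have hS : is_subspace S by exact: supported_is_subspace.
have hI := subspaceP (Imult V k.+1).
pose wim := linext (fun w : {fmonom V} => word_image w).
have wim0 : wim 0 = 0 by exact: linear0.
pose G : set ({malg K[{fmonom V}]} * A) :=
  [set p | exists t v, [/\ S t, Imult V k.+1 v, p.1 = t + v & p.2 = wim t]].
have hG : linear_graph G.
  split; first split.
  - exists 0, 0; split; [by case: hS|by case: hI|by rewrite addr0|].
    by rewrite wim0.
  - move=> c [x1 x2] [y1 y2] [t [v [St Iv /= -> ->]]].
    move=> [t' [v' [St' Iv' /= -> ->]]].
    exists (c *: t + t'), (c *: v + v'); split => /=.
    + exact: (proj2 hS c _ _ St St').
    + exact: (proj2 hI c _ _ Iv Iv').
    + by rewrite scalerDr addrACA.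
    + by rewrite /wim [RHS]linearP.
  - move=> y [t [v [St Iv /= /eqP]]]; rewrite eq_sym addr_eq0 => /eqP tv ->.
    apply: word_image_Imult hP PE _ St.
    by rewrite tv -scaleN1r; exact: (subspaceZ (-1) hI Iv).
have [h hE] := linear_graph_extension hG.
exists (fun s => h (tup s)); split=> [s1 s2 sk c a b|s sk hs].
  have := @Imult_slot_linear K V s1 s2 c a b; rewrite sk => hi.
  apply/eqP; rewrite -subr_eq0 -linearP -linearB; apply/eqP/esym/hE.
  exists 0, (tup (s1 ++ (c *: a + b) :: s2)
     - (c *: tup (s1 ++ a :: s2) + tup (s1 ++ b :: s2))); split => //=.
  - by case: hS.
  - by rewrite add0r.
apply/esym/hE; exists (tup s), 0; split => /=.
- exact: supported1.
- by case: hI.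
- by rewrite addr0.
- by rewrite /wim linext_tup.
Qed.

Lemma multilinear_extension :
  exists P, (forall k, multilinear k P) /\
    forall s, indep topV s -> P s = word_image s.
Proof.
have [Q hQ] := choice multilinear_extension_size.
exists (fun s => Q (size s) s); split=> [k s1 s2 sk c a b|s hs].
  rewrite !size_cat /= !addnS sk.
  by case: (hQ k) => hk _; exact: hk.
by case: (hQ (size s)) => _; apply.
Qed.

End MultilinearExtension.

(** * Universal property of the locality tensor algebra *)

Section Quotients.
Local Open Scope ring_scope.
Variables (K : fieldType) (E F : lmodType K) (W : subspace E).

Lemma vquot_lift (h : {linear E -> F}) :
  (forall x, W x -> h x = 0) ->
  exists h' : {linear vquot W -> F}, forall x, h' (vproj W x) = h x.
Proof.
move=> hW.
have hE x : h (vrepr (vproj W x)) = h x.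
  apply/eqP; rewrite -subr_eq0 -linearB; apply/eqP/hW/vproj_eq.
  by rewrite vreprK.
have hl : linear (fun x : vquot W => h (vrepr x)).
  move=> c x y; rewrite -[x]vreprK -[y]vreprK -linearP !hE.
  by rewrite linearP.
have [h' h'E] := linear_bundle hl.
by exists h' => x; rewrite h'E.
Qed.

End Quotients.

Section TensorUniversal.
Local Open Scope ring_scope.
Local Open Scope classical_set_scope.
Variables (K : fieldType) (V A : lmodType K).
Variables (topV : V -> V -> Prop) (top : A -> A -> Prop).
Variables (m : A -> A -> A) (u : K -> A) (f : V -> A).
Hypothesis hA : locality_algebra top m u.
Hypothesis topVC : forall x y, topV x y -> topV y x.
Hypothesis hf : locality_linear topV top f.

Lemma top_linext (X Y : choiceType) (h : X -> A) (h' : Y -> A)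
    (a : {malg K[X]}) (b : {malg K[Y]}) :
  (forall k k', k \in msupp a -> k' \in msupp b -> top (h k) (h' k')) ->
  top (linext h a) (linext h' b).
Proof.
move=> hh'.
apply: (@linext_in_subspace K _ _ (polar top [set linext h' b])) => //.
  exact: (polar_subspace hA).
move=> k ka _ ->; apply: (alg_topC hA).
apply: (@linext_in_subspace K _ _ (polar top [set h k])) => //.
  exact: (polar_subspace hA).
by move=> k' kb _ ->; apply: (alg_topC hA); exact: hh'.
Qed.

Lemma mul_linextl (X : choiceType) (h : X -> A) (a : {malg K[X]}) z :
  (forall k, k \in msupp a -> top (h k) z) ->
  m (linext h a) z = linext (fun k => m (h k) z) a.
Proof.
move=> hz; rewrite /linext !big_seq.
pose R x y := top x z /\ m x z = y.
suff [] : R (\sum_(k <- msupp a | k \in msupp a) a@_k *: h k)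
            (\sum_(k <- msupp a | k \in msupp a) a@_k *: m (h k) z) by [].
apply: big_ind2 => [|x1 x2 y1 y2 [t1 <-] [t2 <-]|k ka].
- by split; [exact: top0 hA _|exact: mul0l hA _].
- have := top_lin hA 1 t1 t2; have := mulDl hA 1 t1 t2.
  by rewrite !scale1r => ? ?; split.
- have t0 := top0 hA z.
  have := top_lin hA a@_k (hz k ka) t0; have := mulDl hA a@_k (hz k ka) t0.
  by rewrite addr0 (mul0l hA) addr0 => ? ?; split.
Qed.

Lemma mul_linextr (X : choiceType) (h : X -> A) (a : {malg K[X]}) z :
  (forall k, k \in msupp a -> top z (h k)) ->
  m z (linext h a) = linext (fun k => m z (h k)) a.
Proof.
move=> hz; rewrite /linext !big_seq.
pose R x y := top x z /\ m z x = y.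
suff [] : R (\sum_(k <- msupp a | k \in msupp a) a@_k *: h k)
            (\sum_(k <- msupp a | k \in msupp a) a@_k *: m z (h k)) by [].
apply: big_ind2 => [|x1 x2 y1 y2 [t1 <-] [t2 <-]|k ka].
- by split; [exact: top0 hA _|exact: mul0r hA _].
- have := top_lin hA 1 t1 t2.
  have := mulDr hA 1 (alg_topC hA t1) (alg_topC hA t2).
  by rewrite !scale1r => ? ?; split.
- have t0 := top0 hA z; have tk := alg_topC hA (hz k ka).
  have := top_lin hA a@_k tk t0.
  have := mulDr hA a@_k (hz k ka) (alg_topC hA t0).
  by rewrite addr0 (mul0r hA) addr0 => ? ?; split.
Qed.

Lemma mul_linext (X Y : choiceType) (h : X -> A) (h' : Y -> A)
    (a : {malg K[X]}) (b : {malg K[Y]}) :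
  (forall k k', k \in msupp a -> k' \in msupp b -> top (h k) (h' k')) ->
  m (linext h a) (linext h' b) =
  linext (fun k => linext (fun k' => m (h k) (h' k')) b) a.
Proof.
move=> hh'; rewrite mul_linextl.
  by apply: eq_in_linext => k ka; apply: mul_linextr => k' kb; exact: hh'.
move=> k ka; rewrite -[h k]linext1; apply: top_linext => k1 k'.
by rewrite msuppU oner_eq0 inE => /eqP -> kb; exact: hh'.
Qed.

Definition word_map (t : Ftens topV) : A :=
  linext (fun w : lword topV => word_image m u f (val w)) t.

Lemma lword_indep (w : lword topV) : indep topV (val w).
Proof. by apply/asboolP; exact: valP w. Qed.

Lemma Fincl1 (w : lword topV) : Fincl << w >> = << val w >>.
Proof. exact: linext1. Qed.

(** A multilinear extension P is defined on all words, so it can be evaluated on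
    the image of t in the full tensor algebra, where relations and products
    live. *)
Lemma linext_Fincl (P : seq V -> A) t :
  (forall s, indep topV s -> P s = word_image m u f s) ->
  linext (fun w : {fmonom V} => P w) (Fincl t) = word_map t.
Proof.
move=> PE; rewrite /Fincl (linear_linext (linext _)).
apply: eq_in_linext => w _ /=; rewrite linext1.
exact/PE/lword_indep.
Qed.

Lemma word_image_cat s1 s2 :
  indep topV (s1 ++ s2) ->
  word_image m u f (s1 ++ s2) = m (word_image m u f s1) (word_image m u f s2).
Proof.
move=> h; rewrite /word_image map_cat; apply: (wprod_cat hA).
by rewrite -map_cat; exact: (indep_map hA topVC hf).
Qed.

Lemma mul_tup (c : K) (s s' : seq V) :
  tup s * (c *: tup s') = c *: tup (s ++ s').
Proof.
rewrite /tup !scale_malg1 malgM_def fgmulUU mul1r; congr mkmalgU; exact: fmmulE.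
Qed.

(** The product of combinations of words, in the bilinear form to which
    [mul_linext] can be compared. *)
Lemma mul_Fincl (a b : Ftens topV) :
  Fincl a * Fincl b =
  linext (fun w : lword topV =>
    linext (fun w' : lword topV => tup (val w ++ val w')) b) a.
Proof.
rewrite /Fincl /linext mulr_suml; apply: eq_bigr => w _.
rewrite mulr_sumr scaler_sumr; apply: eq_bigr => w' _.
rewrite -scalerAl; congr (_ *: _).
by case: (val w) (val w') => s [s']; exact: mul_tup.
Qed.

Lemma top_word_map n a b : topF topV n a b -> top (word_map a) (word_map b).
Proof.
move=> [_ _ ab]; apply: top_linext => w w' wa w'b.
apply: (top_word_image hA topVC hf); try exact: lword_indep.
by move=> x y; exact: ab.
Qed.

Lemma word_map_mul n (a b c : Ftens topV) :
  topF topV n a b -> Fincl c = Fincl a * Fincl b ->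
  word_map c = m (word_map a) (word_map b).
Proof.
move=> [_ _ ab] cE.
have [P [Pmul PE]] := multilinear_extension hA topVC hf.
rewrite mul_linext; last first.
  move=> w w' wa w'b; apply: (top_word_image hA topVC hf);
    try exact: lword_indep.
  by move=> x y; exact: ab.
rewrite -(linext_Fincl _ PE) cE mul_Fincl (linear_linext (linext _)).
apply: eq_in_linext => w wa /=; rewrite (linear_linext (linext _)).
apply: eq_in_linext => w' w'b /=; rewrite linext_tup /=.
have ww' : indep topV (val w ++ val w').
  apply: (indep_cat topVC); try exact: lword_indep.
  by move=> x y; exact: ab.
by rewrite PE // word_image_cat.
Qed.

Lemma word_map_ImultF t : ImultF topV t -> word_map t = 0.
Proof.
have [P [Pmul PE]] := multilinear_extension hA topVC hf.
rewrite -(linext_Fincl _ PE) => tI.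
pose h := linext (fun w : {fmonom V} => P w).
apply: (@span_sub _ _ _ [set t | h t = 0] _ _ _ tI).
  exact: kernel_is_subspace.
by move=> t' [k [_ tk]]; exact: (linext_Imult (Pmul k) tk).
Qed.

Theorem tensor_alg_universal :
  exists T : {linear tensor_alg topV -> A},
    (forall t, T (vproj (ImultF topV) t) = word_map t) /\
    locality_algebra_morphism (tensor_top topV) (tensor_mul topV)
      (tensor_unit topV) top (graph top m) u T.
Proof.
have [T TE] := @vquot_lift _ _ _ (ImultF topV) (linext _) word_map_ImultF.
exists T; split=> //; split.
- split; first exact: linearP.
  by move=> _ _ [n [a [b [ab -> ->]]]]; rewrite !TE; exact: top_word_map ab.
- move=> _ _ _ [n [a [b [c [ab -> -> -> cE]]]]]; rewrite !TE; split.
    exact: top_word_map ab.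
  exact: word_map_mul ab cE.
- by move=> c; rewrite TE linearZ_LR /= linext1 [RHS](unitZ hA).
Qed.

End TensorUniversal.

(** * Universal property of the enveloping algebra *)

Section Enveloping.
Local Open Scope ring_scope.
Local Open Scope classical_set_scope.
Variables (K : fieldType) (g A : lmodType K).
Variables (topg : g -> g -> Prop) (br : g -> g -> g) (top : A -> A -> Prop).
Variables (m : A -> A -> A) (u : K -> A) (f : g -> A).
Hypothesis hA : locality_algebra top m u.
Hypothesis topgC : forall x y, topg x y -> topg y x.
Hypothesis hf : locality_lie_morphism topg br top (commutator m) f.

(** The ideal of bracket relations is the smallest one containing the
    generators, and the kernel of T is an ideal: if T x = 0 and x y is
    defined, then T (x y) = 0 * T y = 0. The generators are killed because f
    is a Lie morphism. *)
Lemma Jlie_kernel (T : {linear tensor_alg topg -> A}) :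
  (forall t, T (vproj (ImultF topg) t) = word_map m u f t) ->
  locality_algebra_morphism (tensor_top topg) (tensor_mul topg)
    (tensor_unit topg) top (graph top m) u T ->
  forall x, Jlie topg br x -> T x = 0.
Proof.
move=> TE [_ Tmul _] x /(_ [set y | T y = 0]); apply.
  split=> [|x1 x2 x3 /= Tx1 _ [/Tmul|/Tmul] [_ ->]].
  - exact: kernel_is_subspace.
  - by rewrite Tx1 (mul0l hA).
  - by rewrite Tx1 (mul0r hA).
move=> _ [a [b [t [ab -> tE]]]] /=.
have [P [Pmul PE]] := multilinear_extension hA topgC (proj1 hf).
rewrite TE -(linext_Fincl _ PE) tE 2!(linearB (linext _)) /= !linext_tup /=.
rewrite !PE ?/word_image /= ?(mul_unitr hA).
- by rewrite (proj2 hf) // /commutator subrr.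
- exact: indep_seq1.
- by apply: (indep_seq2 topgC); exact: topgC.
- exact: indep_seq2.
Qed.

Lemma envel_morphism_exists :
  exists phi : envel topg br -> A,
    locality_algebra_morphism (envel_top topg br) (envel_mul topg br)
      (envel_unit topg br) top (graph top m) u phi /\
    f = phi \o iota_lie topg br.
Proof.
have [T [TE TM]] := tensor_alg_universal hA topgC (proj1 hf).
have [phi phiE] := vquot_lift (Jlie_kernel TE TM).
case: TM => [[_ Ttop] Tmul Tunit]; exists phi; split.
  split=> [|_ _ _ [a [b [c [abc -> -> ->]]]]|c].
  - split; first exact: linearP.
    by move=> _ _ [a [b [ab -> ->]]]; rewrite !phiE; exact: Ttop.
  - by rewrite !phiE; exact: Tmul.
  - by rewrite phiE Tunit.
apply: funext => x; rewrite /= phiE TE /word_map linext1.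
by rewrite /word_image /= (mul_unitr hA).
Qed.

(** The step by which every independent word is a product of letters; it drives
    the induction for uniqueness. *)
Lemma tensor_mul_cons x (w w' : lword topg) :
  val w' = FMonom (x :: val w) ->
  tensor_mul topg (tensor_iota topg x)
    (vproj (ImultF topg) << w >>) (vproj (ImultF topg) << w' >>).
Proof.
move=> w'E.
exists (size (val w)).+1, << lword1 topg x >>, << w >>, << w' >>; split=> //.
  have hx : forall y, y \in (val w : seq g) -> topg x y.
    by have := @lword_indep K g topg w'; rewrite w'E => /(indep_cons topgC)[].
  split.
  - by apply: (@supported1 K _ [set v : lword topg | (size (val v) <= _)%N]).
  - apply: (@supported1 K _ [set v : lword topg | (size (val v) <= _)%N]) => /=.
    exact: leqnSn.
  - have vE (k k' : lword topg) : k' \in msupp (<< k >> : Ftens topg) -> k' = k.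
      by apply: (@supported1 K _ [set k]).
    move=> v v' /vE -> /vE -> y z /=.
    by rewrite in_cons in_nil orbF => /eqP -> /hx.
have mulE (p p' q q' r r' : {malg K[{fmonom g}]}) :
  p = p' -> q = q' -> r = r' -> p' = q' * r' -> p = q * r by move=> -> -> ->.
apply: (mulE _ _ _ _ _ _ (Fincl1 w') (Fincl1 _) (Fincl1 w)).
rewrite w'E; case: (val w) => s /=.
by have := mul_tup 1 [:: x] s; rewrite !scale1r => /esym.
Qed.

(** The values on words are forced: the empty word is the unit, and a longer
    word is the product of its first letter by the remaining word. *)
Lemma envel_morphism_word (phi : envel topg br -> A) :
  locality_algebra_morphism (envel_top topg br) (envel_mul topg br)
    (envel_unit topg br) top (graph top m) u phi ->
  f = phi \o iota_lie topg br ->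
  forall w : lword topg,
    phi (vproj (Jlie topg br) (vproj (ImultF topg) << w >>)) =
    word_image m u f (val w).
Proof.
move=> [_ phiM phi1] phif [[s] hs] /=; elim: s hs => [|x s IH] hs.
  rewrite -[RHS]phi1 /envel_unit /tensor_unit scale1r.
  congr (phi (vproj _ (vproj _ << _ >>))).
  exact: val_inj.
have [/= hx hs'] : (forall y, y \in s -> topg x y) /\ indep topg s.
  by apply/(indep_cons topgC)/asboolP.
pose w' : lword topg := exist _ (FMonom s) (introT (asboolP _) hs').
have [] // := phiM (iota_lie topg br x)
  (vproj (Jlie topg br) (vproj (ImultF topg) << w' >>))
  (vproj (Jlie topg br) (vproj (ImultF topg)
    << exist _ (FMonom (x :: s)) hs : lword topg >>)).
  exists (tensor_iota topg x), (vproj (ImultF topg) << w' >>),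
    (vproj (ImultF topg) << exist _ (FMonom (x :: s)) hs : lword topg >>).
  by split=> //; exact: tensor_mul_cons.
move=> _ ->; rewrite -[RHS]/(m (f x) (word_image m u f s)).
by apply: congr2; [rewrite phif | exact: IH].
Qed.

Lemma envel_morphism_unique (phi phi' : envel topg br -> A) :
  locality_algebra_morphism (envel_top topg br) (envel_mul topg br)
    (envel_unit topg br) top (graph top m) u phi ->
  f = phi \o iota_lie topg br ->
  locality_algebra_morphism (envel_top topg br) (envel_mul topg br)
    (envel_unit topg br) top (graph top m) u phi' ->
  f = phi' \o iota_lie topg br ->
  phi = phi'.
Proof.
move=> hphi phif hphi' phif'; apply: funext => x.
have [[/linear_bundle[h hE] _] _ _] := hphi.
have [[/linear_bundle[h' hE'] _] _ _] := hphi'.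
rewrite -[x]vreprK -[vrepr x]vreprK [vrepr (vrepr x)]malg_basis_sum.
rewrite -hE -hE' !linear_sum; apply: eq_bigr => w _.
rewrite !linearZ_LR hE hE'; congr (_ *: _).
by rewrite (envel_morphism_word hphi phif) (envel_morphism_word hphi' phif').
Qed.

End Enveloping.

Theorem theorem7p8 (K : fieldType) (hK : is_R_or_C K)
    (g : lmodType K) (topg : g -> g -> Prop) (br : g -> g -> g)
    (hg : locality_lie_algebra topg br)
    (A : lmodType K) (topA : A -> A -> Prop) (mA : A -> A -> A) (uA : K -> A)
    (hA : locality_algebra topA mA uA)
    (f : g -> A)
    (hf : locality_lie_morphism topg br topA (commutator mA) f)
    (ha : forall n : nat,
        locality_compatible (topF topg n) (ImultF_upto topg n))
    (hb : locality_compatible (tensor_top topg) (Jlie topg br)) :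
  exists! phi : envel topg br -> A,
    locality_algebra_morphism
      (envel_top topg br) (envel_mul topg br) (envel_unit topg br)
      topA (graph topA mA) uA phi
    /\ f = phi \o iota_lie topg br.
Proof.
have topgC x y : topg x y -> topg y x by case: hg => -[+ _ _] _; apply.
have [phi [hphi phif]] := envel_morphism_exists hA topgC hf.
exists phi; split=> // phi' [hphi' phif'].
exact: (envel_morphism_unique topgC hphi phif hphi' phif').
Qed.
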